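(* The number of monic irreducible polynomials of degree $d$ in $\mathbb{F}_{q^r}[X,\sigma]$ is $$\frac{q^{dr}-1}{d(q^d-1)}\sum_{i\mid d}\mu\left(\frac{d}{i}\right)q^i,$$ where $\mu$ is the Möbius function.
   Context: Let $p$ be a prime, $q=p^a$ a power of $p$, $r\ge1$ and $d\ge 1$ integers, and $\sigma(x)=x^q$ on $\mathbb{F}_{q^r}$. $\mathbb{F}_{q^r}[X,\sigma]$ is the skew polynomial ring with $X\cdot c=\sigma(c)\cdot X$ for $c\in\mathbb{F}_{q^r}$.
   Formalization: The case d = 1, r ≥ 2 is excluded, since there the formula is false: all q^r monic polynomials X − a are irreducible, while the formula gives q + q^2 + … + q^r (for q = r = 2: 4 versus 6). *)

(* Defs.v *)
From HB Require Import structures.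
From mathcomp Require Import all_boot all_order all_algebra.

Set Implicit Arguments.
Unset Strict Implicit.
Unset Printing Implicit Defensive.

Import GRing.Theory.
Local Open Scope ring_scope.

(* R[X, sigma]: the additive group of {poly R} (coefficients on the left of
   the powers of X) with the product twisted by X * c = sigma c * X.         *)
Definition skewpoly (R : nzRingType) (sigma : {rmorphism R -> R}) : Type :=
  {poly R}.

HB.instance Definition _ (R : nzRingType) (sigma : {rmorphism R -> R}) :=
  GRing.Zmodule.on (@skewpoly R sigma).

Section SkewProduct.

Variables (R : nzRingType) (sigma : {rmorphism R -> R}).
Implicit Types (c : R) (f g h : {poly R}).

Lemma iter_rmorph0 i : iter i sigma 0 = 0.
Proof. by elim: i => //= i ->; rewrite rmorph0. Qed.

Lemma iter_rmorph1 i : iter i sigma 1 = 1.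
Proof. by elim: i => //= i ->; rewrite rmorph1. Qed.

Lemma iter_rmorphD i : {morph iter i sigma : x y / x + y}.
Proof. by elim: i => // i IH x y; rewrite !iterS IH rmorphD. Qed.

Lemma iter_rmorphM i : {morph iter i sigma : x y / x * y}.
Proof. by elim: i => // i IH x y; rewrite !iterS IH rmorphM. Qed.

(* (c X^i) * g = c * sigma^i(g) * X^i *)
Definition skew_term c i g : {poly R} :=
  c *: (map_poly (iter i sigma) g * 'X^i).

Definition skew_mul f g : {poly R} := \sum_(i < size f) skew_term f`_i i g.

Lemma coef_skew_term c i g k :
  (skew_term c i g)`_k = if (k < i)%N then 0 else c * iter i sigma g`_(k - i).
Proof.
rewrite coefZ coefMXn; case: ifP => _; first by rewrite mulr0.
by rewrite coef_map_id0 // iter_rmorph0.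
Qed.

Lemma skew_termDl c d i g :
  skew_term (c + d) i g = skew_term c i g + skew_term d i g.
Proof. by rewrite /skew_term scalerDl. Qed.

Lemma skew_termDr c i g h :
  skew_term c i (g + h) = skew_term c i g + skew_term c i h.
Proof.
apply/polyP => k; rewrite coefD !coef_skew_term coefD.
by case: ifP => _; rewrite ?addr0 // iter_rmorphD mulrDr.
Qed.

Lemma skew_term0l i g : skew_term 0 i g = 0.
Proof. by rewrite /skew_term scale0r. Qed.

Lemma skew_term_monomial a i b j :
  skew_term a i (b *: 'X^j) = (a * iter i sigma b) *: 'X^(i + j).
Proof.
apply/polyP => k; rewrite coef_skew_term !coefZ !coefXn.
case: ltnP => [lt_ki | le_ik].
  by rewrite ltn_eqF ?mulr0 // ltn_addr.
rewrite -(eqn_add2l i) subnKC //.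
by case: eqP => _; rewrite ?mulr1 // !mulr0 iter_rmorph0 mulr0.
Qed.

Lemma skew_mulE n f g :
  (size f <= n)%N -> skew_mul f g = \sum_(i < n) skew_term f`_i i g.
Proof.
move=> le_fn; rewrite /skew_mul (big_ord_widen n (fun i => skew_term f`_i i g)) //.
rewrite big_mkcond /=; apply: eq_bigr => i _; case: ltnP => // le_fi.
by rewrite nth_default // skew_term0l.
Qed.

Lemma skew_mulDl : left_distributive skew_mul +%R.
Proof.
move=> f g h /=; set n := maxn (size f) (size g).
have le_fgn : (size (f + g)%R <= n)%N by apply: size_polyD.
rewrite (skew_mulE h le_fgn) (@skew_mulE n f h (leq_maxl _ _)).
rewrite (@skew_mulE n g h (leq_maxr _ _)) -big_split /=.
by apply: eq_bigr => i _; rewrite coefD skew_termDl.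
Qed.

Lemma skew_mulDr : right_distributive skew_mul +%R.
Proof.
move=> f g h; rewrite /skew_mul -big_split /=.
by apply: eq_bigr => i _; rewrite skew_termDr.
Qed.

Lemma skew_mul0l f : skew_mul 0 f = 0.
Proof. by rewrite /skew_mul size_poly0 big_ord0. Qed.

Lemma skew_mul0r f : skew_mul f 0 = 0.
Proof. by apply: (addrI (skew_mul f 0)); rewrite -skew_mulDr !addr0. Qed.

Lemma skew_mul_monomiall c i g : skew_mul (c *: 'X^i) g = skew_term c i g.
Proof.
have le_i : (size (c *: 'X^i : {poly R}) <= i.+1)%N.
  by apply: leq_trans (size_scale_leq _ _) _; rewrite size_polyXn.
rewrite (skew_mulE _ le_i) (bigD1 ord_max) //= big1 ?addr0.
  by rewrite coefZ coefXn eqxx mulr1.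
move=> j; rewrite -val_eqE /= => ne_ji.
by rewrite coefZ coefXn (negPf ne_ji) mulr0 skew_term0l.
Qed.

Lemma skew_mul_monomial a i b j :
  skew_mul (a *: 'X^i) (b *: 'X^j) = (a * iter i sigma b) *: 'X^(i + j).
Proof. by rewrite skew_mul_monomiall skew_term_monomial. Qed.

Lemma polyE_monomials f : f = \sum_(i < size f) f`_i *: 'X^i.
Proof. by rewrite -poly_def coefK. Qed.

Lemma skew_monomial_ind (P : {poly R} -> Prop) :
  P 0 -> (forall f g, P f -> P g -> P (f + g)) ->
  (forall c i, P (c *: 'X^i)) -> forall f, P f.
Proof.
move=> P0 PD PX f; rewrite (polyE_monomials f).
by apply: (big_ind P) => // i _; apply: PX.
Qed.

Lemma skew_mulA : associative skew_mul.
Proof.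
move=> f g h; elim/skew_monomial_ind: f => [|f1 f2 IH1 IH2|a i].
- by rewrite !skew_mul0l.
- by rewrite !skew_mulDl IH1 IH2.
elim/skew_monomial_ind: g => [|g1 g2 IH1 IH2|b j].
- by rewrite !(skew_mul0l, skew_mul0r).
- by rewrite !(skew_mulDl, skew_mulDr) IH1 IH2.
elim/skew_monomial_ind: h => [|h1 h2 IH1 IH2|c k].
- by rewrite !skew_mul0r.
- by rewrite !skew_mulDr IH1 IH2.
by rewrite !skew_mul_monomial iter_rmorphM mulrA -iterD addnA.
Qed.

Lemma skew_mul1l : left_id (1 : {poly R}) skew_mul.
Proof.
move=> f; rewrite -[1 in LHS](expr0 'X) -[X in skew_mul X](scale1r) skew_mul_monomiall.
by apply/polyP => k; rewrite coef_skew_term /= subn0 mul1r.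
Qed.

Lemma skew_mul1r : right_id (1 : {poly R}) skew_mul.
Proof.
move=> f; rewrite [RHS]polyE_monomials; apply: eq_bigr => i _.
rewrite -[1](expr0 'X) -['X^0 in LHS]scale1r skew_term_monomial iter_rmorph1.
by rewrite mulr1 addn0.
Qed.

End SkewProduct.

HB.instance Definition _ (R : nzRingType) (sigma : {rmorphism R -> R}) :=
  GRing.Zmodule_isNzRing.Build (@skewpoly R sigma)
    (@skew_mulA R sigma) (@skew_mul1l R sigma) (@skew_mul1r R sigma)
    (@skew_mulDl R sigma) (@skew_mulDr R sigma) (oner_neq0 {poly R}).

Lemma skewpolyX_const (R : nzRingType) (sigma : {rmorphism R -> R}) (c : R) :
  ('X : skewpoly sigma) * (c%:P : skewpoly sigma) =
  ((sigma c)%:P : skewpoly sigma) * ('X : skewpoly sigma).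
Proof.
change (skew_mul sigma 'X c%:P = skew_mul sigma (sigma c)%:P 'X).
have E (d : R) : d%:P = d *: 'X^0 by rewrite expr0 alg_polyC.
have EX : 'X = 1 *: 'X^1 :> {poly R} by rewrite scale1r.
by rewrite EX !E !skew_mul_monomial /= mul1r mulr1.
Qed.

Section SkewUnits.

Variables (F : fieldType) (sigma : {rmorphism F -> F}).
Implicit Types f g : skewpoly sigma.

Lemma iter_rmorph_eq0 i (x : F) : (iter i sigma x == 0) = (x == 0).
Proof. by elim: i => //= i <-; rewrite fmorph_eq0. Qed.

Lemma size_skew_mul (f g : {poly F}) : f != 0 -> g != 0 ->
  size (skew_mul sigma f g) = (size f + size g).-1.
Proof.
move=> nz_f nz_g; have sz_f := nz_f; have sz_g := nz_g.
rewrite -size_poly_gt0 in sz_f; rewrite -size_poly_gt0 in sz_g.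
have lead : (skew_mul sigma f g)`_((size f).-1 + (size g).-1) != 0.
  rewrite /skew_mul coef_sum.
  have lt_f : ((size f).-1 < size f)%N by rewrite prednK.
  rewrite (bigD1 (Ordinal lt_f)) //= big1 => [|i ne_i].
    rewrite addr0 coef_skew_term ltnNge leq_addr /= addKn.
    by rewrite mulf_neq0 ?iter_rmorph_eq0 // -lead_coefE lead_coef_eq0.
  rewrite coef_skew_term; case: ifP => // _.
  have lt_i : (i < (size f).-1)%N.
    rewrite ltn_neqAle; apply/andP; split; last by rewrite -ltnS prednK.
    by rewrite -val_eqE in ne_i.
  rewrite [g`__]nth_default ?iter_rmorph0 ?mulr0 //.
  by rewrite -addnBAC ?(ltnW lt_i) // -(ltn_predK sz_g) -add1n leq_add2r subn_gt0.
have szE : (size f + size g).-1 = ((size f).-1 + (size g).-1).+1.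
  by rewrite -(prednK sz_f) -(prednK sz_g) /= addnS.
rewrite szE; apply/eqP; rewrite eqn_leq; apply/andP; split; last first.
  by rewrite ltnNge; apply: contra lead => ?; rewrite nth_default.
apply/leq_sizeP => k lt_k; rewrite /skew_mul coef_sum big1 // => i _.
rewrite coef_skew_term; case: ifP => // _.
rewrite [g`__]nth_default ?iter_rmorph0 ?mulr0 //.
rewrite -(prednK sz_g); apply: leq_trans (_ : k - (size f).-1 <= _)%N.
  by rewrite ltn_subRL.
by rewrite leq_sub2l // -ltnS prednK.
Qed.

Definition skew_unit f : bool := size (f : {poly F}) == 1%N.

Definition skew_inv f : skewpoly sigma :=
  if skew_unit f then ((f : {poly F})`_0)^-1%:P else f.

Lemma skew_mul_const (a b : F) : skew_mul sigma a%:P b%:P = (a * b)%:P.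
Proof.
have E (d : F) : d%:P = d *: 'X^0 by rewrite expr0 alg_polyC.
by rewrite !E skew_mul_monomial.
Qed.

Lemma skew_mulVr : {in skew_unit, left_inverse 1 skew_inv *%R}.
Proof.
move=> f; rewrite unfold_in => Uf; rewrite /skew_inv /skew_unit Uf.
have /size_poly1P[c nz_c Ef] := Uf; change (f = c%:P) in Ef.
change (skew_mul sigma ((f : {poly F})`_0)^-1%:P f = 1).
by rewrite Ef coefC /= skew_mul_const mulVf.
Qed.

Lemma skew_divrr : {in skew_unit, right_inverse 1 skew_inv *%R}.
Proof.
move=> f; rewrite unfold_in => Uf; rewrite /skew_inv /skew_unit Uf.
have /size_poly1P[c nz_c Ef] := Uf; change (f = c%:P) in Ef.
change (skew_mul sigma f ((f : {poly F})`_0)^-1%:P = 1).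
by rewrite Ef coefC /= skew_mul_const mulfV.
Qed.

Lemma skew_unitP f g : g * f = 1 /\ f * g = 1 -> skew_unit f.
Proof.
case=> gf1 _; change (skew_mul sigma g f = 1) in gf1; rewrite /skew_unit.
have nz_g : (g : {poly F}) != 0.
  by apply/eqP => g0; move/eqP: gf1; rewrite g0 skew_mul0l eq_sym oner_eq0.
have nz_f : (f : {poly F}) != 0.
  by apply/eqP => f0; move/eqP: gf1; rewrite f0 skew_mul0r eq_sym oner_eq0.
have := size_skew_mul nz_g nz_f; rewrite gf1 size_poly1.
rewrite -size_poly_gt0 in nz_g; rewrite -size_poly_gt0 in nz_f.
by case: (size g) nz_g => // -[|m] _; case: (size f) nz_f => // -[|k] _ //=;
  rewrite ?addnS.
Qed.

Lemma skew_inv_out : {in [predC skew_unit], skew_inv =1 id}.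
Proof. by move=> f nUf; rewrite /skew_inv; case: ifP => // Uf; case/negP: nUf. Qed.

End SkewUnits.

HB.instance Definition _ (F : fieldType) (sigma : {rmorphism F -> F}) :=
  GRing.NzRing_hasMulInverse.Build (@skewpoly F sigma)
    (@skew_mulVr F sigma) (@skew_divrr F sigma) (@skew_unitP F sigma)
    (@skew_inv_out F sigma).

Definition irreducible_elt (A : unitRingType) (f : A) : Prop :=
  [/\ f != 0, f \isn't a GRing.unit &
      forall g h : A, f = g * h -> (g \is a GRing.unit) || (h \is a GRing.unit)].

(* size is degree + 1 *)
Definition monic_irreducible_deg (F : fieldType) (sigma : {rmorphism F -> F})
    (d : nat) (f : skewpoly sigma) : Prop :=
  [/\ (f : {poly F}) \is monic, size (f : {poly F}) = d.+1 & irreducible_elt f].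

(* Only used for n > 0: the value at n = 0 is junk. *)
Definition moebius (n : nat) : int :=
  if all (fun p => logn p n == 1%N) (primes n) then (-1) ^+ size (primes n) else 0.

(* Main.v *)
Require Import Defs.
From HB Require Import structures.
From mathcomp Require Import all_boot all_order all_algebra all_field.
From mathcomp Require Import zify ring.

Set Implicit Arguments.
Unset Strict Implicit.
Unset Printing Implicit Defensive.

Import GRing.Theory.
Local Open Scope ring_scope.

(** Let K be the fixed field of sigma and L a finite extension of F in which
    all polynomials involved split. F[X, sigma] acts on L with X acting as
    v |-> v^q, and T = X^r spans with K a central subring K[T]. Let N in K[T]
    be irreducible of degree d and v != 0 killed by N. The q^d elements h v
    with h in K[T] show that no nonzero skew polynomial of degree < d kills v,
    while the vectors v^(q^i), i <= d, lie in ker N, an F-space of dimension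
    d, so that some monic skew polynomial of degree d kills v. It is unique
    and irreducible, and every irreducible skew polynomial of degree d > 1
    arises in this way from all the nonzero elements of its kernel. Counting
    the nonzero v killed by some N in two ways gives
      #irreducible skew polynomials * (q^d - 1) = #{N} * (q^(rd) - 1),
    and d * #{N} is the number of elements of L of exact period d under the
    q-Frobenius, which Moebius inversion evaluates. *)

(** * Skew polynomials acting as linearized polynomials *)

(* The linearized polynomial sum_i f_i x^(Q^i) attached to sum_i f_i X^i. *)
Definition qassoc (Q : nat) (R : nzRingType) (f : {poly R}) : {poly R} :=
  \sum_(i < size f) f`_i *: 'X^(Q ^ i).

(** [Q] and the coefficient field stay free because two actions are needed: skew polynomials over
    [F] with exponent [q], and K[T] with exponent [q ^ r]. *)
Definition qeval (Q : nat) (R L : fieldType) (iota : {rmorphism R -> L})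
    (f : {poly R}) (v : L) : L :=
  (map_poly iota (qassoc Q f)).[v].

Section Evaluation.

Variables (p k Q : nat) (R L : fieldType).
Variables (sigma : {rmorphism R -> R}) (iota : {rmorphism R -> L}).
Hypotheses (charL : p \in [pchar L]) (k_gt0 : (0 < k)%N) (defQ : Q = (p ^ k)%N).
Hypothesis iota_sigma : forall c, iota (sigma c) = iota c ^+ Q.
Implicit Types (f g : {poly R}) (v w : L).

Local Notation ev := (qeval Q iota).

Lemma Q_gt1 : (1 < Q)%N.
Proof.
by rewrite defQ -(exp1n k) ltn_exp2r // prime_gt1 // (pcharf_prime charL).
Qed.

Lemma exprQD i v w : (v + w) ^+ (Q ^ i) = v ^+ (Q ^ i) + w ^+ (Q ^ i).
Proof.
apply: exprDn_pchar; rewrite (eq_pnat _ (pcharf_eq charL)) defQ -expnM pnatX.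
by rewrite pnat_id ?(pcharf_prime charL).
Qed.

Lemma qevalE n f v : (size f <= n)%N ->
  ev f v = \sum_(i < n) iota f`_i * v ^+ (Q ^ i).
Proof.
move=> le_fn; rewrite /qeval /qassoc rmorph_sum /= horner_sum.
rewrite (big_ord_widen n
  (fun i => (map_poly iota (f`_i *: 'X^(Q ^ i))).[v])) // big_mkcond /=.
apply: eq_bigr => i _; rewrite map_polyZ map_polyXn hornerZ hornerXn.
by case: ltnP => // le_fi; rewrite nth_default // rmorph0 mul0r.
Qed.

Lemma qevalDl f g v : ev (f + g) v = ev f v + ev g v.
Proof.
have le_fgn : (size (f + g)%R <= maxn (size f) (size g))%N by apply: size_polyD.
rewrite (qevalE v le_fgn) (@qevalE (maxn (size f) (size g)) f) ?leq_maxl //.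
rewrite (@qevalE (maxn (size f) (size g)) g) ?leq_maxr // -big_split /=.
by apply: eq_bigr => i _; rewrite coefD rmorphD mulrDl.
Qed.

Lemma qeval0l v : ev 0 v = 0.
Proof. by rewrite (@qevalE 0) ?size_poly0 // big_ord0. Qed.

Lemma qeval1 v : ev 1 v = v.
Proof. by rewrite (@qevalE 1) ?size_poly1 // big_ord1 coefC rmorph1 mul1r. Qed.

Lemma qevalBl f g v : ev (f - g) v = ev f v - ev g v.
Proof. by apply/eqP; rewrite eq_sym subr_eq -qevalDl subrK. Qed.

Lemma qevalDr f v w : ev f (v + w) = ev f v + ev f w.
Proof.
rewrite !(@qevalE (size f)) // -big_split /=.
by apply: eq_bigr => i _; rewrite exprQD mulrDr.
Qed.

Lemma qeval0r f : ev f 0 = 0.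
Proof. by apply: (addrI (ev f 0)); rewrite -qevalDr !addr0. Qed.

Lemma qeval_monomial c i v : ev (c *: 'X^i) v = iota c * v ^+ (Q ^ i).
Proof.
rewrite (@qevalE i.+1); last first.
  by apply: leq_trans (size_scale_leq _ _) _; rewrite size_polyXn.
rewrite (bigD1 ord_max) //= big1 ?addr0 => [|j].
  by rewrite coefZ coefXn eqxx mulr1.
rewrite -val_eqE /= => ne_ji.
by rewrite coefZ coefXn (negPf ne_ji) mulr0 rmorph0 mul0r.
Qed.

Lemma iota_iter i c : iota (iter i sigma c) = iota c ^+ (Q ^ i).
Proof.
by elim: i => [|i IH] //=; rewrite iota_sigma IH -exprM -expnSr.
Qed.

(** Additivity reduces this to monomials, where the twist of the product matches the effect of the
    Q-power on coefficients, by [iota_sigma]. *)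
Lemma qeval_mul f g v : ev (skew_mul sigma f g) v = ev f (ev g v).
Proof.
elim/skew_monomial_ind: f => [|f1 f2 IH1 IH2|a i].
- by rewrite skew_mul0l !qeval0l.
- by rewrite skew_mulDl !qevalDl IH1 IH2.
elim/skew_monomial_ind: g => [|g1 g2 IH1 IH2|b j].
- by rewrite skew_mul0r qeval0l qeval0r.
- by rewrite skew_mulDr !qevalDl qevalDr IH1 IH2.
rewrite skew_mul_monomial !qeval_monomial rmorphM iota_iter exprMn -mulrA.
by rewrite -exprM -expnD addnC.
Qed.

Lemma size_qassoc f : f != 0 -> size (qassoc Q f) = (Q ^ (size f).-1).+1.
Proof.
move=> nz_f; rewrite /qassoc; have := nz_f; rewrite -size_poly_gt0.
case Ef: (size f) => [|n] // _; rewrite big_ord_recr /= addrC.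
have nz_l : f`_n != 0 by have:= nz_f; rewrite -lead_coef_eq0 lead_coefE Ef.
have szl: size (f`_n *: 'X^(Q ^ n) : {poly R}) = (Q ^ n).+1.
  by rewrite size_scale // size_polyXn.
rewrite size_polyDl // szl ltnS; apply: (leq_trans (size_sum _ _ _)).
apply/bigmax_leqP => i _; apply: leq_trans (size_scale_leq _ _) _.
by rewrite size_polyXn ltn_exp2l ?Q_gt1.
Qed.

Lemma qassoc_eq0 f : (qassoc Q f == 0) = (f == 0).
Proof.
apply/idP/idP => [|/eqP->]; last by rewrite /qassoc size_poly0 big_ord0.
by apply: contraLR => nz_f; rewrite -size_poly_gt0 size_qassoc.
Qed.

(** Every exponent [Q ^ i] with [i > 0] vanishes in characteristic [p], so only the linear term
    survives. *)
Lemma deriv_qassoc f : (map_poly iota (qassoc Q f))^`() = (iota f`_0)%:P.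
Proof.
have Q0 : Q%:R = 0 :> L.
  by rewrite defQ natrX (pcharf0 charL) expr0n -[k]prednK.
rewrite /qassoc rmorph_sum raddf_sum /=.
have E i : (map_poly iota (f`_i *: 'X^(Q ^ i)))^`() =
    if i == 0%N then (iota f`_0)%:P else 0.
  rewrite map_polyZ map_polyXn derivZ derivXn.
  case: i => [|i] /=; first by rewrite expr0 alg_polyC.
  by rewrite -mulr_natr -polyC_natr expnS natrM Q0 mul0r polyC0 mulr0 scaler0.
rewrite (eq_bigr (fun i : 'I_(size f) => if val i == 0%N then (iota f`_0)%:P else 0));
  last by move=> i _; apply: E.
case: (size f) (nth_default 0 (s := f)) => [->|n _] //.
  by rewrite big_ord0 rmorph0.
by rewrite big_ord_recl /= big1 ?addr0.
Qed.

End Evaluation.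

(** * Sizes of kernels *)

Section KernelCard.

Variables (p k Q : nat) (R : fieldType) (L : finFieldType).
Variables (iota : {rmorphism R -> L}).
Hypotheses (charL : p \in [pchar L]) (k_gt0 : (0 < k)%N) (defQ : Q = (p ^ k)%N).
Implicit Types (f g : {poly R}).

Definition qker f : {set L} := [set v | qeval Q iota f v == 0].

Lemma qker_card_le f : f != 0 -> (#|qker f| <= Q ^ (size f).-1)%N.
Proof.
move=> nz_f.
have nz_a : map_poly iota (qassoc Q f) != 0.
  by rewrite map_poly_eq0 (qassoc_eq0 charL k_gt0 defQ).
rewrite -ltnS -(size_qassoc charL k_gt0 defQ nz_f) -(size_map_poly iota) cardE.
apply: max_poly_roots => //; last exact: enum_uniq.
by apply/allP => v; rewrite mem_enum inE.
Qed.

(** The derivative is a nonzero constant, so the linearized polynomial is separable and its roots in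
    [rs] are distinct. *)
Lemma qker_card f (rs : seq L) : f`_0 != 0 ->
  map_poly iota (qassoc Q f) %= \prod_(z <- rs) ('X - z%:P) ->
  #|qker f| = (Q ^ (size f).-1)%N.
Proof.
move=> nz_f0 split_f.
have nz_f : f != 0 by apply: contraNneq nz_f0 => ->; rewrite coef0.
have Urs : uniq rs.
  rewrite -separable_prod_XsubC -(eqp_separable split_f) separable_poly.unlock.
  rewrite (deriv_qassoc iota charL k_gt0 defQ) -alg_polyC coprimepZr ?fmorph_eq0 //.
  exact: coprimep1.
apply: succn_inj; rewrite -(size_qassoc charL k_gt0 defQ nz_f).
rewrite -(size_map_poly iota) (eqp_size split_f) size_prod_XsubC; congr _.+1.
rewrite cardE; apply/perm_size/uniq_perm; rewrite ?enum_uniq // => v.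
by rewrite mem_enum inE -root_prod_XsubC -(eqp_root split_f).
Qed.

End KernelCard.

(** * Double counting and lists of monic polynomials *)

(** The fibres over [s] have [n] elements each, and the last two hypotheses say that they partition
    [S]. *)
Lemma double_count (T : eqType) (L : finType) (s : seq T) (S : {set L})
    (e : T -> L -> bool) n :
    uniq s -> {in s, forall x, #|[set v in S | e x v]| = n} ->
    {in S, forall v, exists2 x, x \in s & e x v} ->
    {in S, forall v, {in s &, forall x y, e x v -> e y v -> x = y}} ->
  #|S| = (size s * n)%N.
Proof.
move=> Us card_e ex_e uniq_e.
have count1 v : v \in S -> count (e^~ v) s = 1%N.
  move=> Sv; have [x sx exv] := ex_e v Sv.
  rewrite -[RHS](_ : count_mem x s = 1%N); last by rewrite count_uniq_mem // sx.
  apply: eq_in_count => y sy; apply/idP/eqP => [eyv | -> //].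
  exact: uniq_e Sv _ _ sy sx eyv exv.
rewrite -sum1_card (eq_bigr (fun v => \sum_(x <- s | e x v) 1)%N); last first.
  by move=> v Sv; rewrite sum1_count count1.
rewrite (exchange_big_dep predT) //= big_seq_cond.
rewrite (eq_bigr (fun=> n)) => [|x /andP[sx _]].
  by rewrite -big_seq_cond big_const_seq count_predT iter_addn_0 mulnC.
by rewrite -(card_e x sx) -sum1_card; apply: eq_bigl => v; rewrite inE.
Qed.

Lemma size_monic_sub (R : nzRingType) d (f g : {poly R}) :
  f \is monic -> size f = d.+1 -> g \is monic -> size g = d.+1 ->
  (size (f - g)%R <= d)%N.
Proof.
move=> mon_f szf mon_g szg; apply/leq_sizeP => j le_dj; rewrite coefB.
case: (ltngtP d j) le_dj => // [lt_dj|<-] _.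
  by rewrite !nth_default ?szf ?szg // subrr.
move: mon_f mon_g; rewrite !monicE !lead_coefE szf szg /= => /eqP-> /eqP->.
by rewrite subrr.
Qed.

Definition monic_polys (R : finNzRingType) d : seq {poly R} :=
  [seq 'X^d + polyn f | f <- enum {: {poly_d R}}].

Lemma monic_polys_uniq (R : finNzRingType) d : uniq (monic_polys R d).
Proof.
by rewrite map_inj_uniq ?enum_uniq // => f g /addrI/val_inj.
Qed.

Lemma mem_monic_polys (R : finNzRingType) d (f : {poly R}) :
  (f \in monic_polys R d) = (f \is monic) && (size f == d.+1).
Proof.
apply/mapP/andP => [[g _ ->] | [mon_f /eqP szf]].
  have lt_g : (size (g : {poly R}) < size ('X^d : {poly R}))%N.
    by rewrite size_polyXn ltnS size_npoly.
  by rewrite monicE lead_coefDl // lead_coefXn size_polyDl // size_polyXn !eqxx.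
have szg : (size (f - 'X^d)%R <= d)%N.
  by apply: size_monic_sub; rewrite ?monicXn ?size_polyXn.
by exists (NPoly szg); rewrite ?mem_enum //= addrC subrK.
Qed.

Definition monic_irreducibles (K : finFieldType) d : seq {poly K} :=
  [seq N <- monic_polys K d | irreducibleb N].

Lemma monic_irreducibles_uniq (K : finFieldType) d : uniq (monic_irreducibles K d).
Proof. by rewrite filter_uniq ?monic_polys_uniq. Qed.

Lemma monic_irreduciblesP (K : finFieldType) d (N : {poly K}) :
  reflect [/\ irreducible_poly N, N \is monic & size N = d.+1]
          (N \in monic_irreducibles K d).
Proof.
rewrite mem_filter mem_monic_polys; apply: (iffP and3P).
  by case=> /irreducibleP irrN monN /eqP szN.
by case=> irrN monN szN; split=> //; [apply/irreducibleP | apply/eqP].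
Qed.

Lemma irreducible_poly_monic (K : fieldType) (h : {poly K}) (c := (lead_coef h)^-1) :
  irreducible_poly h -> irreducible_poly (c *: h) /\ c *: h \is monic.
Proof.
move=> irr_h; have nz_h := irredp_neq0 irr_h.
have nz_c : c != 0 by rewrite invr_eq0 lead_coef_eq0.
have eq_h := eqp_scale h nz_c; split; last first.
  by rewrite monicE lead_coefZ mulVf ?lead_coef_eq0.
split=> [|g ne_g1]; first by rewrite (eqp_size eq_h); case: irr_h.
by rewrite (eqp_dvdr _ eq_h) (eqp_rtrans eq_h); case: irr_h => _; apply.
Qed.

(** A zero constant coefficient makes [X] a divisor, hence an associate, of [N], which forces degree
    1. *)
Lemma irreducible_coef0 (K : fieldType) d (N : {poly K}) :
  irreducible_poly N -> size N = d.+1 -> (1 < d)%N -> N`_0 != 0.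
Proof.
move=> [_ irrN] szN d_gt1; apply: contraTneq d_gt1 => N0.
have dvdX : 'X %| N by rewrite -['X]subr0 -polyC0 dvdp_XsubCl /root horner_coef0 N0.
have := irrN 'X; rewrite size_polyX => /(_ isT dvdX) /eqp_size.
by rewrite size_polyX szN => -[<-].
Qed.

(** * Factors, trivial twist and division for skew polynomials *)

(** With zero constant coefficient, [f] is a left multiple of [X]: multiplying by [X] on the right
    only shifts coefficients, as [sigma] fixes 1. Irreducibility then makes the cofactor
    constant. *)
Lemma skew_irreducible_coef0 (F : fieldType) (sigma : {rmorphism F -> F}) d
    (f : {poly F}) :
  irreducible_elt (f : skewpoly sigma) -> size f = d.+1 -> (1 < d)%N ->
  f`_0 != 0.
Proof.
move=> [_ _ irr_f] szf d_gt1; apply: contraTneq d_gt1 => f0.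
pose g : {poly F} := \poly_(i < d) f`_i.+1.
have def_f : f = skew_mul sigma g 'X.
  have szg : (size g <= d)%N by apply: size_poly.
  rewrite (skew_mulE sigma 'X szg); apply/polyP => j; rewrite coef_sum.
  have E (i : 'I_d) : (skew_term sigma g`_i i 'X)`_j = if j == i.+1 then f`_j else 0.
    rewrite coef_skew_term coefX coef_poly ltn_ord.
    have [lt_ji | le_ij] := ltnP j i; first by rewrite ltn_eqF // ltnW.
    rewrite -(eqn_add2r i) subnK // addSn add0n; case: eqP => [-> | _].
      by rewrite iter_rmorph1 mulr1.
    by rewrite iter_rmorph0 mulr0.
  rewrite (eq_bigr _ (fun i _ => E i)) -big_mkcond /=.
  case: j {E} => [|j]; first by rewrite big_pred0.
  have [lt_jd | le_dj] := ltnP j d.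
    by rewrite (big_pred1 (Ordinal lt_jd)) // => i; rewrite eqSS eq_sym.
  rewrite big_pred0 ?nth_default ?szf // => i.
  by rewrite eqSS; apply/negbTE; rewrite neq_ltn (leq_trans (ltn_ord i)) ?orbT.
rewrite -leqNgt; have:= irr_f g 'X def_f.
change ((size g == 1%N) || (size ('X : {poly F}) == 1%N) -> (d <= 1)%N).
rewrite size_polyX orbF => /eqP szg.
have nz_g : g != 0 by rewrite -size_poly_gt0 szg.
have nzX : 'X != 0 :> {poly F} by rewrite polyX_eq0.
have := size_skew_mul sigma nz_g nzX.
by rewrite -def_f szf szg size_polyX => -[->].
Qed.

(** This lets the multiplicativity of evaluation be reused for the commutative ring K[T]. *)
Lemma skew_mul_id (R : nzRingType) (f g : {poly R}) :
  skew_mul (idfun : {rmorphism R -> R}) f g = f * g.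
Proof.
rewrite [in RHS](polyE_monomials f) mulr_suml; apply: eq_bigr => i _.
rewrite /skew_term map_poly_id => [|x _]; last by elim: (val i) => //= j ->.
by rewrite -scalerAl commr_polyXn.
Qed.

(** The divisor stands on the right, so the remainder agrees with [f] on vectors killed by [g]. A
    monomial times [g] removes the leading term; the twist is harmless because [g] is monic. *)
Lemma skew_edivp (F : fieldType) (sigma : {rmorphism F -> F})
    (f g : {poly F}) e : g \is monic -> size g = e.+1 ->
  exists c, (size (f - skew_mul sigma c g)%R <= e)%N.
Proof.
move=> mon_g szg; have [n] := ubnP (size f).
elim: n f => // n IH f; rewrite ltnS => le_fn.
have [le_fe | lt_ef] := leqP (size f) e; first by exists 0; rewrite skew_mul0l subr0.
pose m := (size f).-1; pose c0 : {poly F} := lead_coef f *: 'X^(m - e).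
have szf : size f = m.+1 by rewrite prednK // (leq_ltn_trans _ lt_ef).
have le_em : (e <= m)%N by rewrite -ltnS -szf.
have [|c szc] := IH (f - skew_mul sigma c0 g).
  apply: leq_trans le_fn; rewrite szf ltnS; apply/leq_sizeP => j le_mj.
  rewrite coefB skew_mul_monomiall coef_skew_term ltnNge.
  rewrite (leq_trans (leq_subr _ _) le_mj) /=.
  case: (ltngtP m j) le_mj => // [lt_mj|<-] _.
    by rewrite !nth_default ?iter_rmorph0 ?mulr0 ?subr0 ?szf ?szg //; lia.
  rewrite subKn //; move/monicP: mon_g; rewrite lead_coefE szg /= => ->.
  by rewrite iter_rmorph1 mulr1 lead_coefE szf subrr.
by exists (c0 + c); rewrite skew_mulDl opprD addrA.
Qed.

(** * Annihilators by the pigeonhole principle *)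

Section Pigeonhole.

Variables (Q : nat) (R L : finFieldType) (iota : {rmorphism R -> L}).

(** With more polynomials than possible values at [v], two of them agree there, and their difference
    kills [v]. *)
Lemma qeval_pigeonhole n (v : L) (S : {set L}) :
    (forall f : {poly R}, (size f <= n)%N -> qeval Q iota f v \in S) ->
    (#|S| < #|R| ^ n)%N ->
  exists f : {poly R}, [/\ f != 0, (size f <= n)%N & qeval Q iota f v = 0].
Proof.
move=> inS ltS; pose ev (f : {poly_n R}) := qeval Q iota f v.
have [inj | /injectivePn[f [g ne_fg eq_fg]]] := boolP (injectiveb ev).
  have : (#|[set ev f | f : {poly_n R}]| <= #|S|)%N.
    apply/subset_leq_card/subsetP => _ /imsetP[f _ ->].
    exact/inS/size_npoly.
  by rewrite card_imset ?card_npoly 1?leqNgt ?ltS //; apply/injectiveP.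
exists (f - g : {poly R}); split.
- by rewrite subr_eq0.
- by apply: leq_trans (size_polyD _ _) _; rewrite size_polyN geq_max !size_npoly.
by rewrite qevalBl; move: eq_fg; rewrite /ev => ->; rewrite subrr.
Qed.

End Pigeonhole.

(** * Irreducible skew polynomials as annihilators of vectors *)

Section Correspondence.

Variables (p a q r : nat) (K F L : finFieldType).
Variables (kappa : {rmorphism K -> F}) (iota : {rmorphism F -> L}).
Variable sigma : {rmorphism F -> F}.
Hypotheses (charL : p \in [pchar L]) (a_gt0 : (0 < a)%N) (defq : q = (p ^ a)%N).
Hypotheses (r_gt0 : (0 < r)%N) (cardK : #|K| = q) (cardF : #|F| = (q ^ r)%N).
Hypothesis sigmaE : forall x, sigma x = x ^+ q.
Implicit Types (f g : {poly F}) (h N : {poly K}) (u v : L) (d e : nat).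

Local Notation iotaK := ((iota \o kappa) : {rmorphism K -> L}).
Local Notation ev := (qeval q iota).
(* K[T] acts on L through T = X^r, that is, v |-> v^(q^r). *)
Local Notation act := (qeval (q ^ r) iotaK).
Local Notation ker f := (qker q iota f).
Local Notation kerK N := (qker (q ^ r) iotaK N).

Let ar_gt0 : (0 < a * r)%N. Proof. by rewrite muln_gt0 a_gt0. Qed.
Let defqr : (q ^ r)%N = (p ^ (a * r))%N. Proof. by rewrite defq expnM. Qed.
Let q_gt1 : (1 < q)%N. Proof. exact: Q_gt1 charL a_gt0 defq. Qed.

Let iota_sigma c : iota (sigma c) = iota c ^+ q.
Proof. by rewrite sigmaE rmorphXn. Qed.

Let iotaK_id c : iotaK (idfun c) = iotaK c ^+ (q ^ r).
Proof. by rewrite /= -rmorphXn -cardF expf_card. Qed.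

Let act_mul h N v : act (h * N) v = act h (act N v).
Proof.
by rewrite -skew_mul_id (qeval_mul charL defqr (sigma := idfun) iotaK_id).
Qed.

Let iotaFX c i : iota c ^+ ((q ^ r) ^ i) = iota c.
Proof.
elim: i => [|i IH] //; rewrite expnS mulnC exprM IH.
by rewrite -rmorphXn -cardF expf_card.
Qed.

Let iotaKX c i : iotaK c ^+ (q ^ i) = iotaK c.
Proof.
elim: i => [|i IH] //; rewrite expnS mulnC exprM IH.
by rewrite -rmorphXn -cardK expf_card.
Qed.

(** This is the centrality of K[T]: on monomials, the [q ^ r]-power fixes coefficients from [F] and
    the [q]-power those from [K]. *)
Lemma qeval_act f h v : ev f (act h v) = act h (ev f v).
Proof.
have evD := qevalDr iota charL defq; have actD := qevalDr iotaK charL defqr.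
elim/skew_monomial_ind: f => [|f1 f2 IH1 IH2|b i].
- by rewrite !qeval0l (qeval0r iotaK charL defqr).
- by rewrite !qevalDl actD IH1 IH2.
elim/skew_monomial_ind: h => [|h1 h2 IH1 IH2|c j].
- by rewrite !qeval0l (qeval0r iota charL defq).
- by rewrite !qevalDl evD IH1 IH2.
rewrite !qeval_monomial !exprMn iotaFX iotaKX mulrCA.
by congr (_ * (_ * _)); rewrite -!exprM mulnC.
Qed.

(** [h] is coprime to [N], and a Bezout relation acts as the identity on [v]; if both killed [v],
    then [v] would be zero. *)
Lemma act_irreducible_neq0 d N h v : irreducible_poly N -> size N = d.+1 ->
  act N v = 0 -> v != 0 -> h != 0 -> (size h <= d)%N -> act h v != 0.
Proof.
move=> irrN szN Nv0 nz_v nz_h szh; apply: contraNneq nz_v => hv0.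
have: coprimep N h.
  rewrite irreducible_poly_coprime //; apply: contraL szh => /(dvdp_leq nz_h).
  by rewrite szN ltnNge.
case/Bezout_eq1_coprimepP=> -[x y] /= /(congr1 (act^~ v)).
rewrite qevalDl !act_mul Nv0 hv0 !(qeval0r iotaK charL defqr) addr0.
by rewrite qeval1 => <-.
Qed.

(** If [f] had degree below [d], its kernel would have fewer than [q ^ d] elements. It contains
    [h v] for all [h] over [K] of degree below [d], so some nonzero such [h] would kill [v]. *)
Lemma size_annihilator d N f v : irreducible_poly N -> size N = d.+1 ->
  act N v = 0 -> v != 0 -> f != 0 -> ev f v = 0 -> (d < size f)%N.
Proof.
move=> irrN szN Nv0 nz_v nz_f fv0; rewrite ltnNge; apply/negP => le_f.
have inS h : (size h <= d)%N -> act h v \in ker f.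
  by rewrite inE qeval_act fv0 (qeval0r iotaK charL defqr).
have ltS : (#|ker f| < #|K| ^ d)%N.
  apply: leq_ltn_trans (qker_card_le iota charL a_gt0 defq nz_f) _.
  by rewrite cardK ltn_exp2l // prednK // size_poly_gt0.
have [h [nz_h szh hv0]] := qeval_pigeonhole inS ltS.
by have:= act_irreducible_neq0 irrN szN Nv0 nz_v nz_h szh; rewrite hv0 eqxx.
Qed.

(* Pigeonhole: the q^(r(d+1)) skew polynomials of degree <= d map v into ker N,
   which has at most q^(rd) elements. *)
Lemma exists_annihilator d N v : size N = d.+1 -> act N v = 0 ->
  exists f, [/\ f != 0, (size f <= d.+1)%N & ev f v = 0].
Proof.
move=> szN Nv0; apply: (@qeval_pigeonhole q F L iota d.+1 v (kerK N)).
  by move=> f _; rewrite inE -qeval_act Nv0 (qeval0r iota charL defq).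
have nzN : N != 0 by rewrite -size_poly_gt0 szN.
apply: leq_ltn_trans (qker_card_le iotaK charL ar_gt0 defqr nzN) _.
by rewrite cardF szN ltn_exp2l // defqr -(exp1n (a * r)) ltn_exp2r //
  prime_gt1 // (pcharf_prime charL).
Qed.

Lemma exists_monic_annihilator d N v : irreducible_poly N -> size N = d.+1 ->
  act N v = 0 -> v != 0 ->
  exists f, [/\ f \is monic, size f = d.+1 & ev f v = 0].
Proof.
move=> irrN szN Nv0 nz_v.
have [f [nz_f szf fv0]] := exists_annihilator szN Nv0.
have nz_c : (lead_coef f)^-1 != 0 by rewrite invr_eq0 lead_coef_eq0.
exists ((lead_coef f)^-1 *: f); split.
- by rewrite monicE lead_coefZ mulVf ?lead_coef_eq0.
- apply/eqP; rewrite size_scale // eqn_leq szf /=.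
  exact: size_annihilator irrN szN Nv0 nz_v nz_f fv0.
rewrite (@qevalE q _ _ _ (size f)) ?size_scale //.
rewrite (eq_bigr (fun i : 'I__ =>
  iota (lead_coef f)^-1 * (iota f`_i * v ^+ (q ^ i)))).
  by rewrite -mulr_sumr -qevalE // fv0 mulr0.
by move=> i _; rewrite coefZ rmorphM mulrA.
Qed.

Lemma monic_annihilator_uniq d N f g v :
    irreducible_poly N -> size N = d.+1 -> act N v = 0 -> v != 0 ->
    f \is monic -> size f = d.+1 -> ev f v = 0 ->
    g \is monic -> size g = d.+1 -> ev g v = 0 ->
  f = g.
Proof.
move=> irrN szN Nv0 nz_v mon_f szf fv0 mon_g szg gv0.
apply/eqP; rewrite -subr_eq0; apply: contraT => nz_fg.
have fgv0 : ev (f - g) v = 0 by rewrite qevalBl fv0 gv0 subrr.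
have := size_annihilator irrN szN Nv0 nz_v nz_fg fgv0.
by rewrite ltnNge (size_monic_sub mon_f szf mon_g szg).
Qed.

(** In a factorization [f = g h], either [h] kills [v], or [g] kills the nonzero vector [h v], which
    [N] kills too by centrality. Hence one factor has the full degree [d] and the other is
    constant. *)
Lemma annihilator_irreducible d N f v :
    irreducible_poly N -> size N = d.+1 -> act N v = 0 -> v != 0 ->
    size f = d.+1 -> ev f v = 0 ->
  irreducible_elt (f : skewpoly sigma).
Proof.
move=> irrN szN Nv0 nz_v szf fv0.
have nz_f : f != 0 by rewrite -size_poly_gt0 szf.
have d_gt0 : (0 < d)%N by case: irrN => + _; rewrite szN.
split=> // [|g h def_f].
  by change (~~ (size f == 1%N)); rewrite szf eqSS -lt0n.
change ((size (g : {poly F}) == 1%N) || (size (h : {poly F}) == 1%N)).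
change (f = skew_mul sigma g h) in def_f.
have nz_g : (g : {poly F}) != 0.
  by apply: contraNneq nz_f => g0; rewrite def_f g0 skew_mul0l.
have nz_h : (h : {poly F}) != 0.
  by apply: contraNneq nz_f => h0; rewrite def_f h0 skew_mul0r.
have := size_skew_mul sigma nz_g nz_h; rewrite -def_f szf.
have ghv0 : ev g (ev h v) = 0.
  by rewrite -(qeval_mul charL defq iota_sigma) -def_f.
have: (d < size (h : {poly F}))%N || (d < size (g : {poly F}))%N.
  have [hv0 | nz_hv] := eqVneq (ev h v) 0.
    by rewrite (size_annihilator irrN szN Nv0 nz_v nz_h hv0).
  have Nhv0 : act N (ev h v) = 0.
    by rewrite -qeval_act Nv0 (qeval0r iota charL defq).
  by rewrite (size_annihilator irrN szN Nhv0 nz_hv nz_g ghv0) orbT.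
move: nz_g nz_h; rewrite -!size_poly_gt0.
move: (size (g : {poly F})) (size (h : {poly F})) => m n.
by lia.
Qed.

(** Among the nonzero polynomials over [K] killing some nonzero vector of the kernel of [f], one of
    least size is irreducible. *)
Lemma exists_irreducible_annihilator f u : u != 0 -> ev f u = 0 ->
  exists N v, [/\ irreducible_poly N, N \is monic, v != 0, ev f v = 0 & act N v = 0].
Proof.
move=> nz_u fu0.
pose P n := [exists h : {poly_n K}, [exists v : L,
  [&& (h : {poly K}) != 0, v != 0, ev f v == 0 & act h v == 0]]].
have exP : exists n, P n.
  (* The finiteness of [L] provides a first candidate: more than [#|L|] polynomials have size at
     most [#|L|]. *)
  have allS h : (size h <= #|L|)%N -> act h u \in [set: L] by rewrite inE.
  have ltS : (#|[set: L]| < #|K| ^ #|L|)%N by rewrite cardsT cardK ltn_expl.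
  have [h [nz_h szh hu0]] := qeval_pigeonhole allS ltS.
  exists #|L|; apply/existsP; exists (NPoly szh); apply/existsP; exists u.
  by rewrite /= nz_h nz_u fu0 hu0 eqxx.
case: (ex_minnP exP) => n /existsP[hn /existsP[v]].
set h : {poly K} := hn => /=.
case/and4P=> nz_h nz_v /eqP fv0 /eqP hv0 min_n.
have min_h (g : {poly K}) (w : L) :
    g != 0 -> w != 0 -> ev f w = 0 -> act g w = 0 -> (n <= size g)%N.
  move=> nz_g nz_w fw0 gw0; apply: min_n; apply/existsP.
  exists (NPoly (leqnn (size g))); apply/existsP; exists w.
  by rewrite /= nz_g nz_w fw0 gw0 eqxx.
have szh : size h = n.
  by apply/eqP; rewrite eqn_leq size_npoly (min_h h v).
have irr_h : irreducible_poly h.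
  split=> [|g ne_g1 /dvdpP[g' def_h]].
    rewrite ltnNge; apply/negP => /size1_polyC def_h.
    move: hv0 nz_h; rewrite def_h -alg_polyC -(expr0 'X) qeval_monomial.
    rewrite expn0 expr1 => /eqP; rewrite mulf_eq0 (negPf nz_v) orbF fmorph_eq0.
    by move=> /eqP->; rewrite scale0r eqxx.
  have nz_g : g != 0 by apply: contraNneq nz_h => g0; rewrite def_h g0 mulr0.
  have nz_g' : g' != 0 by apply: contraNneq nz_h => g0; rewrite def_h g0 mul0r.
  have dvd_gh : g %| h by rewrite def_h dvdp_mull.
  rewrite -(dvdp_size_eqp dvd_gh) eqn_leq dvdp_leq //= szh.
  (* Either the factor [g] kills [v], or [g v] is a nonzero kernel vector killed by the smaller
     cofactor, against minimality. *)
  have [gv0 | nz_gv] := eqVneq (act g v) 0; first exact: (min_h g v).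
  have fgv0 : ev f (act g v) = 0 by rewrite qeval_act fv0 (qeval0r iotaK charL defqr).
  have := min_h g' (act g v) nz_g' nz_gv fgv0.
  rewrite -act_mul -def_h => /(_ hv0); rewrite -szh def_h size_mul //.
  move: ne_g1 nz_g nz_g'; rewrite -!size_poly_gt0.
  by move: (size g) (size g') => x y; lia.
have [irrN monN] := irreducible_poly_monic irr_h.
exists ((lead_coef h)^-1 *: h), v; split=> //.
by rewrite -mul_polyC act_mul hv0 (qeval0r iotaK charL defqr).
Qed.

(** Some [N] kills a nonzero [v] in the kernel of [f]. Dividing [f] by the monic annihilator of [v]
    shows that [N] has degree [d], and a count shows that K[T] carries [v] onto the whole kernel. *)
Lemma skew_irreducible_annihilator d f : (0 < d)%N ->
    f \is monic -> size f = d.+1 -> irreducible_elt (f : skewpoly sigma) ->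
    #|ker f| = (q ^ d)%N ->
  exists N, [/\ irreducible_poly N, N \is monic, size N = d.+1 &
                forall v, ev f v = 0 -> act N v = 0].
Proof.
move=> d_gt0 mon_f szf irr_f card_f.
have ev0 g : ev g 0 = 0 := qeval0r iota charL defq g.
have act0 h : act h 0 = 0 := qeval0r iotaK charL defqr h.
have [u nz_u fu0] : exists2 u, u != 0 & ev f u = 0.
  have: ker f != [set 0].
    apply: contra_eq_neq card_f => ->; rewrite cards1 neq_ltn -{1}(exp1n d).
    by rewrite ltn_exp2r ?q_gt1.
  have: [set 0] \subset ker f by rewrite sub1set inE ev0.
  rewrite eqEsubset andbC => -> /subsetPn[u]; rewrite !inE => /eqP fu0 nz_u.
  by exists u.
have [N [v [irrN monN nz_v fv0 Nv0]]] := exists_irreducible_annihilator nz_u fu0.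
have [e szN] : exists e, size N = e.+1.
  by exists (size N).-1; case: irrN => /ltnW/prednK->.
have [g [mon_g szg gv0]] := exists_monic_annihilator irrN szN Nv0 nz_v.
have [c szfc] := skew_edivp sigma f mon_g szg.
have cgv0 : ev (f - skew_mul sigma c g) v = 0.
  by rewrite qevalBl (qeval_mul charL defq iota_sigma) gv0 ev0 fv0 subrr.
(* The remainder kills [v] and has degree below [e], so it is zero. *)
have def_f : f = skew_mul sigma c g.
  apply/eqP; rewrite -subr_eq0; apply: contraLR szfc => nz_r.
  by rewrite -ltnNge (size_annihilator irrN szN Nv0 nz_v nz_r cgv0).
have e_gt0 : (0 < e)%N by case: irrN => + _; rewrite szN.
have szc : size c = 1%N.
  case: irr_f => _ _ /(_ c g def_f) /orP[/eqP-> // | ].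
  by change (size g == 1%N -> size c = 1%N); rewrite szg eqSS eqn0Ngt e_gt0.
have def_e : e = d.
  have nz_c : c != 0 by rewrite -size_poly_gt0 szc.
  have nz_g : g != 0 by rewrite -size_poly_gt0 szg.
  by have := size_skew_mul sigma nz_c nz_g; rewrite -def_f szf szc szg => -[].
rewrite {e}def_e in szN szg e_gt0 szfc *; exists N; split=> // w fw0.
(* The [q ^ d] vectors [h v] with [h] of degree below [d] are distinct and fill the kernel of
   [f]. *)
have: [set act (h : {poly_d K}) v | h : {poly_d K}] == ker f.
  rewrite eqEcard; apply/andP; split.
    apply/subsetP => _ /imsetP[h _ ->].
    by rewrite inE qeval_act fv0 act0.
  rewrite card_f card_imset ?card_npoly ?cardK // => h1 h2 /eqP.
  rewrite -subr_eq0 -qevalBl => eq_h; apply/val_inj/eqP; rewrite -subr_eq0 /=.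
  apply: contraLR eq_h => nz_h.
  apply: act_irreducible_neq0 irrN szN Nv0 nz_v nz_h _.
  by apply: leq_trans (size_polyD _ _) _; rewrite size_polyN geq_max !size_npoly.
move/eqP/setP/(_ w); rewrite [in RHS]inE fw0 eqxx => /imsetP[h _ ->].
by rewrite -act_mul mulrC act_mul Nv0 act0.
Qed.

(** * Counting the killed vectors in two ways *)

Section Splitting.

Variables (B d : nat).
Hypothesis split_L : forall g : {poly F}, g != 0 -> (size g <= B)%N ->
  exists rs : seq L, map_poly iota g %= \prod_(z <- rs) ('X - z%:P).
Hypotheses (d_gt1 : (1 < d)%N) (B_large : (q ^ (r * d) < B)%N).

Local Notation P := (monic_irreducibles K d).

Let S := [set v | (v != 0) && has (fun N => act N v == 0) P].

Let memS v : reflect (v != 0 /\ exists2 N, N \in P & act N v = 0) (v \in S).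
Proof.
rewrite inE; apply: (iffP andP) => -[nz_v].
  by case/hasP=> N PN /eqP; split=> //; exists N.
by case=> N PN Nv0; split=> //; apply/hasP; exists N; rewrite ?Nv0.
Qed.

Let card_ker f : f`_0 != 0 -> size f = d.+1 -> #|ker f| = (q ^ d)%N.
Proof.
move=> nz_f0 szf; have nz_f : f != 0 by rewrite -size_poly_gt0 szf.
have [||rs split_f] := @split_L (qassoc q f).
- by rewrite (qassoc_eq0 charL a_gt0 defq).
- rewrite (size_qassoc charL a_gt0 defq nz_f) szf (leq_ltn_trans _ B_large) //.
  by rewrite leq_pexp2l ?leq_pmull // ltnW.
by rewrite (qker_card charL a_gt0 defq nz_f0 split_f) szf.
Qed.

Let map_qassoc N :
  map_poly iotaK (qassoc (q ^ r) N) = map_poly iota (map_poly kappa (qassoc (q ^ r) N)).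
Proof. by rewrite -map_poly_comp. Qed.

Let card_kerK N : N \in P -> #|kerK N| = (q ^ (r * d))%N.
Proof.
case/monic_irreduciblesP=> irrN _ szN; have nz_N : N != 0 by rewrite -size_poly_gt0 szN.
have nz_N0 := irreducible_coef0 irrN szN d_gt1.
have [||rs] := @split_L (map_poly kappa (qassoc (q ^ r) N)).
- by rewrite map_poly_eq0 (qassoc_eq0 charL ar_gt0 defqr).
- by rewrite size_map_poly (size_qassoc charL ar_gt0 defqr nz_N) szN -expnM.
rewrite -map_qassoc => split_N.
by rewrite (qker_card charL ar_gt0 defqr nz_N0 split_N) szN expnM.
Qed.

Let card_S : #|S| = (size P * (q ^ (r * d)).-1)%N.
Proof.
apply: (double_count (e := fun N v => act N v == 0)).
- exact: monic_irreducibles_uniq.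
- move=> N PN; rewrite -(card_kerK PN) (cardsD1 0 (kerK N)) inE.
  rewrite (qeval0r iotaK charL defqr) eqxx /=.
  apply: eq_card => v; rewrite inE in_setD1 [in RHS]inE.
  apply/andP/andP => -[]; first by case/memS.
  by move=> nz_v /eqP Nv0; rewrite Nv0; split=> //; apply/memS; split=> //; exists N.
- by move=> v /memS[_ [N PN /eqP]]; exists N.
move=> v /memS[nz_v _] N N' /monic_irreduciblesP[irrN monN szN].
move=> /monic_irreduciblesP[_ monN' szN'] /eqP Nv0 /eqP N'v0.
(* Two monic polynomials of degree [d] differ by one of smaller degree, which kills [v] only if it
   is zero. *)
apply/eqP; rewrite eq_sym -subr_eq0; apply: contraT => nz_NN'.
have le_NN' : (size (N' - N)%R <= d)%N by apply: size_monic_sub.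
have := act_irreducible_neq0 irrN szN Nv0 nz_v nz_NN' le_NN'.
by rewrite qevalBl Nv0 N'v0 subrr eqxx.
Qed.

(** Second count of [S]: each [v] in it has a unique monic annihilator of degree [d], and the
    [q ^ d - 1] nonzero kernel vectors of an irreducible skew polynomial all lie in [S]. *)
Lemma card_skew_irreducible :
  exists s : seq (skewpoly sigma),
    [/\ uniq s, forall f : skewpoly sigma, f \in s <-> monic_irreducible_deg d f &
        (size s * (q ^ d).-1 = size P * (q ^ (r * d)).-1)%N].
Proof.
(* Irreducibility of skew polynomials is stated as a proposition, so the list is cut out by a
   decidable condition instead. *)
pose I := [seq f <- monic_polys F d | [exists v in S, ev f v == 0]].
have memI f : f \in I <-> @monic_irreducible_deg F sigma d f.
  rewrite mem_filter mem_monic_polys; split.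
    case/and3P=> /exists_inP[v /memS[nz_v [N PN Nv0]] /eqP fv0].
    have /monic_irreduciblesP[irrN _ szN] := PN.
    move=> mon_f /eqP szf; split=> //.
    exact: annihilator_irreducible irrN szN Nv0 nz_v szf fv0.
  case=> mon_f szf irr_f; rewrite mon_f szf eqxx !andbT.
  have card_f := card_ker (skew_irreducible_coef0 irr_f szf d_gt1) szf.
  have [N [irrN monN szN kerN]] :=
    skew_irreducible_annihilator (ltnW d_gt1) mon_f szf irr_f card_f.
  have: (1 < #|ker f|)%N by rewrite card_f -(exp1n d) ltn_exp2r // ltnW.
  rewrite (cardsD1 0) inE (qeval0r iota charL defq) eqxx ltnS => /card_gt0P[v].
  rewrite !inE => /andP[nz_v fv0]; apply/exists_inP; exists v => //.
  by apply/memS; split=> //; exists N; [apply/monic_irreduciblesP | apply/kerN/eqP].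
exists (I : seq (skewpoly sigma)); split=> //.
  by rewrite filter_uniq ?monic_polys_uniq.
rewrite -card_S; symmetry; apply: (double_count (e := fun f v => ev f v == 0)).
- by rewrite filter_uniq ?monic_polys_uniq.
- move=> f /memI[mon_f szf irr_f].
  have card_f := card_ker (skew_irreducible_coef0 irr_f szf d_gt1) szf.
  have [N [irrN monN szN kerN]] :=
    skew_irreducible_annihilator (ltnW d_gt1) mon_f szf irr_f card_f.
  rewrite -card_f (cardsD1 0 (ker f)) inE (qeval0r iota charL defq) eqxx /=.
  apply: eq_card => v; rewrite inE in_setD1 [in RHS]inE.
  apply/andP/andP => -[]; first by case/memS.
  move=> nz_v fv0; split=> //; apply/memS; split=> //.
  by exists N; [apply/monic_irreduciblesP | apply/kerN/eqP].
- move=> v Sv; have /memS[nz_v [N /monic_irreduciblesP[irrN monN szN] Nv0]] := Sv.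
  have [f [mon_f szf fv0]] := exists_monic_annihilator irrN szN Nv0 nz_v.
  exists f; last exact/eqP.
  rewrite mem_filter mem_monic_polys mon_f szf eqxx !andbT.
  by apply/exists_inP; exists v; rewrite ?fv0.
move=> v /memS[nz_v [N /monic_irreduciblesP[irrN _ szN] Nv0]] f g /memI[mon_f szf _].
move=> /memI[mon_g szg _] /eqP fv0 /eqP gv0.
exact: monic_annihilator_uniq irrN szN Nv0 nz_v mon_f szf fv0 mon_g szg gv0.
Qed.

End Splitting.

End Correspondence.

(** * Moebius inversion *)

Lemma moebius1 : moebius 1 = 1.
Proof. by []. Qed.

Lemma moebius_primeM p e : prime p -> (0 < e)%N ->
  moebius (p * e) = if (p %| e)%N then 0 else - moebius e.
Proof.
move=> pr_p e_gt0; have p_gt0 := prime_gt0 pr_p; rewrite /moebius.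
have perm_p : ~~ (p %| e)%N -> perm_eq (primes (p * e)) (p :: primes e).
  move=> ndv_pe; apply: uniq_perm; first exact: primes_uniq.
    by rewrite /= primes_uniq mem_primes (negPf ndv_pe) !andbF.
  move=> s; rewrite inE primesM // (primes_prime pr_p) inE.
  by [].
have [dv_pe | ndv_pe] := boolP (p %| e)%N.
  rewrite [all _ _](_ : _ = false) //; apply: contraTF isT => /allP/(_ p).
  rewrite mem_primes pr_p muln_gt0 p_gt0 e_gt0 dvdn_mulr //= => /(_ isT).
  rewrite lognM // logn_prime // eqxx add1n eqSS.
  by rewrite eqn0Ngt logn_gt0 mem_primes pr_p e_gt0 dv_pe.
rewrite (perm_all _ (perm_p ndv_pe)) (perm_size (perm_p ndv_pe)) /=.
rewrite lognM // logn_prime // eqxx -[p in logn p e]/p.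
have -> : logn p e = 0%N.
  by apply/eqP; rewrite eqn0Ngt logn_gt0 mem_primes (negPf ndv_pe) !andbF.
rewrite eqxx /= (@eq_in_all _ _ (fun s => logn s e == 1%N)).
  by case: ifP; rewrite ?oppr0 // exprS mulN1r.
move=> s; rewrite mem_primes => /and3P[pr_s _ dv_se].
rewrite lognM // logn_prime //; case: (s =P p) => // def_s.
by rewrite -def_s dv_se in ndv_pe.
Qed.

(** For a prime [p] and [n = p m], the divisors of [n] are the [p e] with [e] dividing [m], and the
    divisors of [m] prime to [p]. The terms of [p e] and [e] cancel if [p] does not divide [e];
    otherwise that of [p e] is zero. *)
Lemma sum_moebius n : (0 < n)%N -> \sum_(k <- divisors n) moebius k = (n == 1%N)%:R.
Proof.
move=> n_gt0; case: (ltngtP n 1%N) => [|n_gt1|->]; first by rewrite ltnS leqNgt n_gt0.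
  have pr_p := pdiv_prime n_gt1; set p := pdiv n in pr_p.
  have p_gt0 := prime_gt0 pr_p.
  have [m def_n] := dvdnP (pdiv_dvd n); rewrite mulnC -/p in def_n.
  have m_gt0 : (0 < m)%N by move: n_gt0; rewrite def_n muln_gt0 => /andP[].
  rewrite (bigID (fun k => p %| k)%N) /= -big_filter -[X in _ + X]big_filter.
  have E1 : perm_eq [seq k <- divisors n | p %| k]%N [seq (p * e)%N | e <- divisors m].
    apply: uniq_perm; rewrite ?filter_uniq ?divisors_uniq //.
      rewrite map_inj_uniq ?divisors_uniq // => x y /eqP.
      by rewrite eqn_pmul2l // => /eqP.
    move=> k; rewrite mem_filter -dvdn_divisors //; apply/andP/mapP.
      case=> /dvdnP[e ->]; rewrite def_n mulnC dvdn_pmul2l // => dv_em.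
      by exists e; rewrite -?dvdn_divisors.
    case=> e; rewrite -dvdn_divisors // => dv_em ->.
    by rewrite dvdn_mulr // def_n dvdn_pmul2l.
  have E2 : perm_eq [seq k <- divisors n | ~~ (p %| k)]%N
                    [seq e <- divisors m | ~~ (p %| e)]%N.
    apply: uniq_perm; rewrite ?filter_uniq ?divisors_uniq // => k.
    rewrite !mem_filter -!dvdn_divisors //; apply: andb_id2l => ndv_pk.
    by rewrite def_n Gauss_dvdr // coprime_sym prime_coprime.
  rewrite (perm_big _ E1) (perm_big _ E2) /= big_map big_filter.
  rewrite [X in _ + X]big_mkcond -big_split big_seq big1 // => e.
  rewrite -dvdn_divisors // => /dvdn_gt0-/(_ m_gt0) e_gt0.
  by rewrite moebius_primeM //=; case: ifP; rewrite /= ?addr0 ?addNr.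
by rewrite big_seq1.
Qed.

(** If [o] divides [d], then [k = d / i] runs over the divisors of [d / o]; otherwise the sum is
    empty. *)
Lemma sum_moebius_div d o : (0 < d)%N -> (0 < o)%N ->
  \sum_(i <- divisors d | (o %| i)%N) moebius (d %/ i) = (o == d)%:R.
Proof.
move=> d_gt0 o_gt0; have [dv_od | ndv_od] := boolP (o %| d)%N; last first.
  rewrite (_ : o == d = false); last by apply: contraNF ndv_od => /eqP->.
  rewrite big_seq_cond big1 // => i /andP[]; rewrite -dvdn_divisors // => dv_id dv_oi.
  by rewrite (dvdn_trans dv_oi dv_id) in ndv_od.
have do_gt0 : (0 < d %/ o)%N by rewrite divn_gt0 // dvdn_leq.
transitivity (\sum_(k <- divisors (d %/ o)) moebius k); last first.
  by rewrite sum_moebius // -(eqn_pmul2r o_gt0) divnK // mul1n eq_sym.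
rewrite -big_filter -(big_map (fun i => d %/ i)%N xpredT moebius).
apply/perm_big/uniq_perm; rewrite ?divisors_uniq //.
  rewrite map_inj_in_uniq ?filter_uniq ?divisors_uniq // => i j.
  rewrite !mem_filter -!dvdn_divisors // => /andP[_ dv_i] /andP[_ dv_j] eq_ij.
  have di_gt0 : (0 < d %/ i)%N by rewrite divn_gt0 ?(dvdn_gt0 d_gt0) // dvdn_leq.
  by apply/eqP; rewrite -(eqn_pmul2l di_gt0) {2}eq_ij (divnK dv_i) (divnK dv_j).
move=> k; rewrite -dvdn_divisors //; apply/mapP/idP => [[i] | dv_k].
  rewrite mem_filter -dvdn_divisors // => /andP[dv_oi dv_id] ->.
  have di_gt0 : (0 < d %/ i)%N by rewrite divn_gt0 ?(dvdn_gt0 d_gt0) // dvdn_leq.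
  by rewrite dvdn_divRL // -[X in (_ %| X)%N](divnK dv_id) dvdn_pmul2l.
have dv_kd : (k * o %| d)%N by rewrite -dvdn_divRL.
have dv_kd' : (k %| d)%N := dvdn_trans (dvdn_mulr o (dvdnn k)) dv_kd.
have k_gt0 := dvdn_gt0 d_gt0 dv_kd'.
exists (d %/ k)%N; last by rewrite divnA // mulKn.
by rewrite mem_filter -dvdn_divisors // dvdn_div // dvdn_divRL // mulnC dv_kd.
Qed.

(** * Frobenius orbits and irreducible polynomials over [K] *)

Section FrobeniusOrbits.

Variables (p a q : nat) (K L : finFieldType) (iota : {rmorphism K -> L}).
Hypotheses (charL : p \in [pchar L]) (a_gt0 : (0 < a)%N) (defq : q = (p ^ a)%N).
Hypothesis cardK : #|K| = q.
Implicit Types (N h : {poly K}) (x y : L).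

Definition frob x := x ^+ q.

Local Notation "h ^i" := (map_poly iota h) (at level 2, format "h ^i").

Let q_gt1 : (1 < q)%N. Proof. exact: Q_gt1 charL a_gt0 defq. Qed.

Lemma iter_frob n x : iter n frob x = x ^+ (q ^ n).
Proof.
by elim: n => [|n IH] //; rewrite iterS IH /frob -exprM -expnSr.
Qed.

Lemma frob_inj : injective frob.
Proof.
rewrite /frob => x y eq_xy; have := exprQD charL defq 1 (x - y) y.
rewrite expn1 subrK eq_xy -[LHS]add0r => /addIr/esym/eqP.
by rewrite expf_eq0 subr_eq0 => /andP[_ /eqP].
Qed.

Lemma iter_frob_id n x : (iter n frob x == x) = (order frob x %| n)%N.
Proof.
set o := order frob x; have o_gt0 : (0 < o)%N by apply: order_gt0.
have iterM m : iter (m * o) frob x = x.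
  by elim: m => [|m IH] //; rewrite mulSn iterD IH iter_order //; apply: frob_inj.
rewrite {1}(divn_eq n o) addnC iterD iterM; apply/eqP/idP => [fix_x | /eqP->//].
have lt_r : (n %% o < o)%N by rewrite ltn_mod.
by rewrite /dvdn -(findex_iter lt_r) fix_x findex0.
Qed.

Lemma card_fix_frob_le n : (0 < n)%N -> (#|[set x | iter n frob x == x]| <= q ^ n)%N.
Proof.
move=> n_gt0; have qn_gt1 : (1 < q ^ n)%N by rewrite -(exp1n n) ltn_exp2r.
have sz : size ('X^(q ^ n) - 'X : {poly L}) = (q ^ n).+1.
  by rewrite size_polyDl ?size_polyXn // size_polyN size_polyX.
rewrite -ltnS -sz cardE; apply: max_poly_roots; last exact: enum_uniq.
  by rewrite -size_poly_gt0 sz.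
apply/allP => x; rewrite mem_enum inE iter_frob => /eqP fix_x.
by rewrite rootE !hornerE fix_x subrr.
Qed.

(** The fixed points are the roots of X^(q^n) - X, whose derivative is -1, so that they are all
    simple. *)
Lemma card_fix_frob n (rs : seq L) : (0 < n)%N ->
  'X^(q ^ n) - 'X %= \prod_(z <- rs) ('X - z%:P) ->
  #|[set x | iter n frob x == x]| = (q ^ n)%N.
Proof.
move=> n_gt0 split_X; have qn_gt1 : (1 < q ^ n)%N by rewrite -(exp1n n) ltn_exp2r.
have sz : size ('X^(q ^ n) - 'X : {poly L}) = (q ^ n).+1.
  by rewrite size_polyDl ?size_polyXn // size_polyN size_polyX.
have qn0 : (q ^ n)%:R = 0 :> L.
  by rewrite defq -expnM natrX (pcharf0 charL) expr0n muln_eq0 !eqn0Ngt a_gt0 n_gt0.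
have Urs : uniq rs.
  rewrite -separable_prod_XsubC -(eqp_separable split_X) separable_poly.unlock.
  rewrite derivB derivXn derivX -mulr_natr -polyC_natr qn0 mulr0 sub0r.
  by rewrite -[X in coprimep _ X]scaleN1r coprimepZr ?oppr_eq0 ?oner_eq0 // coprimep1.
apply: succn_inj; rewrite -sz (eqp_size split_X) size_prod_XsubC; congr _.+1.
rewrite cardE; apply/perm_size/uniq_perm; rewrite ?enum_uniq // => x.
rewrite mem_enum inE -root_prod_XsubC -(eqp_root split_X) rootE !hornerE.
by rewrite subr_eq0 iter_frob.
Qed.

Lemma horner_frob h x n : h^i.[iter n frob x] = iter n frob h^i.[x].
Proof.
rewrite !iter_frob; elim/poly_ind: h => [|h c IH].
  by rewrite rmorph0 !horner0 expr0n expn_eq0 eqn0Ngt ltnW.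
have iotaX : iota c ^+ (q ^ n) = iota c.
  rewrite -iter_frob; elim: n {IH} => //= n ->.
  by rewrite /frob -rmorphXn -cardK expf_card.
rewrite rmorphD rmorphM /= map_polyX map_polyC /= !hornerE IH.
by rewrite (exprQD charL defq) exprMn iotaX.
Qed.

(** A nonzero polynomial of least size vanishing at [x] is irreducible; X^#|L| - X shows that one
    exists. *)
Lemma minimal_poly x : exists N, [/\ irreducible_poly N, N \is monic & root N^i x].
Proof.
pose P n := [exists h : {poly_n K}, (polyn h != 0) && root (polyn h)^i x].
have exP : exists n, P n.
  pose h : {poly K} := 'X^#|L| - 'X.
  exists (size h); apply/existsP; exists (NPoly (leqnn (size h))).
  apply/andP; split=> /=.
    rewrite -size_poly_gt0 size_polyDl ?size_polyXn // size_polyN size_polyX ltnS.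
    exact: finNzRing_gt1.
  by rewrite rmorphB /= map_polyXn map_polyX rootE !hornerE expf_card subrr.
case: (ex_minnP exP) => n /existsP[hn]; set h : {poly K} := hn => /andP[nz_h hx0] min_n.
have min_h (g : {poly K}) : g != 0 -> root g^i x -> (n <= size g)%N.
  move=> nz_g gx0; apply: min_n; apply/existsP.
  by exists (NPoly (leqnn (size g))); rewrite /= nz_g gx0.
have szh : size h = n by apply/eqP; rewrite eqn_leq size_npoly min_h.
have irr_h : irreducible_poly h.
  split=> [|g ne_g1 /dvdpP[g' def_h]].
    rewrite ltnNge; apply/negP => /size1_polyC def_h; move: hx0 nz_h.
    by rewrite def_h map_polyC rootC fmorph_eq0 polyC_eq0 => ->.
  have nz_g : g != 0 by apply: contraNneq nz_h => g0; rewrite def_h g0 mulr0.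
  have nz_g' : g' != 0 by apply: contraNneq nz_h => g0; rewrite def_h g0 mul0r.
  have dvd_gh : g %| h by rewrite def_h dvdp_mull.
  rewrite -(dvdp_size_eqp dvd_gh) eqn_leq dvdp_leq //= szh.
  move: hx0; rewrite def_h rmorphM rootM => /orP[g'x0 | gx0]; last exact: min_h.
  have := min_h g' nz_g' g'x0; rewrite -szh def_h size_mul //.
  move: ne_g1 nz_g nz_g'; rewrite -!size_poly_gt0.
  by move: (size g) (size g') => m m'; lia.
have [irrN monN] := irreducible_poly_monic irr_h.
exists ((lead_coef h)^-1 *: h); split=> //.
by rewrite map_polyZ rootZ ?fmorph_eq0 // invr_eq0 lead_coef_eq0.
Qed.

Lemma irreducible_root_neq0 N h x : irreducible_poly N -> root N^i x ->
  h != 0 -> (size h < size N)%N -> ~~ root h^i x.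
Proof.
move=> irrN Nx0 nz_h lt_hN; apply/negP => hx0.
have: coprimep N^i h^i.
  rewrite coprimep_map irreducible_poly_coprime //.
  by apply: contraL lt_hN => /(dvdp_leq nz_h); rewrite -leqNgt.
by move/coprimep_root/(_ Nx0); rewrite -rootE hx0.
Qed.

(* K[x] has q^d elements, all fixed by the o-th power of the Frobenius, where o
   is the period of x; conversely the o conjugates of x are roots of N. *)
Lemma order_frob d N x : irreducible_poly N -> size N = d.+1 -> root N^i x ->
  order frob x = d.
Proof.
move=> irrN szN Nx0; set o := order frob x.
have nz_N : N != 0 := irredp_neq0 irrN.
have le_od : (o <= d)%N.
  rewrite -ltnS -szN -(size_map_poly iota N) /o -size_orbit.
  apply: max_poly_roots; rewrite ?map_poly_eq0 ?orbit_uniq //.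
  apply/allP => _ /trajectP[j _ ->].
  by rewrite rootE horner_frob (rootP Nx0) iter_frob expr0n expn_eq0 eqn0Ngt ltnW.
apply/eqP; rewrite eqn_leq le_od -(leq_exp2l _ _ q_gt1).
apply: leq_trans (card_fix_frob_le (order_gt0 frob x)).
pose e (h : {poly_d K}) := (polyn h)^i.[x].
rewrite -cardK -card_npoly -(card_imset _ (_ : injective e)).
  apply/subset_leq_card/subsetP => _ /imsetP[h _ ->].
  by rewrite inE /e -horner_frob iter_order //; apply: frob_inj.
move=> g h; rewrite /e => /eqP; rewrite -subr_eq0 -hornerN -hornerD -rmorphB -rootE.
move=> ghx0; apply/val_inj/eqP; rewrite -subr_eq0 /=; apply: contraLR ghx0 => nz_gh.
apply: irreducible_root_neq0 irrN Nx0 nz_gh _.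
by rewrite szN ltnS (leq_trans (size_polyD _ _)) // size_polyN geq_max !size_npoly.
Qed.

(** Each [N] has at most [d] roots, and the orbit of any root supplies [d]; conversely, the minimal
    polynomial of an element of period [d] has degree [d]. *)
Lemma card_order_frob d :
    (forall N, irreducible_poly N -> size N = d.+1 -> exists x, root N^i x) ->
  #|[set x | order frob x == d]| =
    (size (monic_irreducibles K d) * d)%N.
Proof.
move=> rootN; apply: (double_count (e := fun N x => root N^i x)).
- exact: monic_irreducibles_uniq.
- move=> N /monic_irreduciblesP[irrN monN szN]; have nz_N := irredp_neq0 irrN.
  have [x Nx0] := rootN N irrN szN; apply/eqP; rewrite eqn_leq; apply/andP; split.
    rewrite -ltnS -szN -(size_map_poly iota N) cardE.
    apply: max_poly_roots; rewrite ?map_poly_eq0 ?enum_uniq //.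
    by apply/allP => y; rewrite mem_enum inE => /andP[].
  rewrite -[X in (X <= _)%N](order_frob irrN szN Nx0) -size_orbit.
  rewrite -(card_uniqP (orbit_uniq frob x)); apply/subset_leq_card/subsetP => y.
  case/trajectP=> j _ ->.
  have Ny0 : root N^i (iter j frob x).
    by rewrite rootE horner_frob (rootP Nx0) iter_frob expr0n expn_eq0 eqn0Ngt ltnW.
  by rewrite !inE Ny0 (order_frob irrN szN Ny0) eqxx.
- move=> x; rewrite inE => /eqP ord_x; have [N [irrN monN Nx0]] := minimal_poly x.
  exists N => //; apply/monic_irreduciblesP; split=> //.
  have szN : size N = (size N).-1.+1 by case: irrN => /ltnW/prednK.
  by rewrite szN -(order_frob irrN szN Nx0) ord_x.
move=> x _ N N' /monic_irreduciblesP[irrN monN szN].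
move=> /monic_irreduciblesP[_ monN' szN'] Nx0 N'x0.
apply/eqP; rewrite eq_sym -subr_eq0; apply: contraT => nz_NN'.
have le_NN' : (size (N' - N)%R < size N)%N by rewrite szN ltnS size_monic_sub.
have := irreducible_root_neq0 irrN Nx0 nz_NN' le_NN'.
by rewrite rmorphB rootE hornerD hornerN (rootP Nx0) (rootP N'x0) subrr eqxx.
Qed.

(** [q ^ i] counts the elements whose period divides [i]; after exchanging the sums, the inner
    Moebius sum singles out period [d]. *)
Lemma card_order_frob_moebius d : (0 < d)%N ->
    (forall n, (0 < n <= d)%N -> #|[set x | iter n frob x == x]| = (q ^ n)%N) ->
  #|[set x | order frob x == d]|%:Z =
    \sum_(i <- divisors d) moebius (d %/ i) * (q ^ i)%:Z.
Proof.
move=> d_gt0 card_fix.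
rewrite big_seq (eq_bigr (fun i => \sum_(x : L)
    if (order frob x %| i)%N then moebius (d %/ i) else 0)); last first.
  move=> i; rewrite -dvdn_divisors // => dv_id.
  have i_gt0 := dvdn_gt0 d_gt0 dv_id; have le_id := dvdn_leq d_gt0 dv_id.
  rewrite -card_fix; last by rewrite i_gt0.
  rewrite -big_mkcond sumr_const.
  rewrite -mulr_natr natz; congr (_ * (Posz _)); apply: eq_card => x.
  by rewrite inE iter_frob_id.
rewrite -big_seq exchange_big /= (eq_bigr (fun x => (order frob x == d)%:R)).
  by rewrite -natr_sum natz -sum1dep_card big_mkcond.
by move=> x _; rewrite -big_mkcond sum_moebius_div ?order_gt0.
Qed.

End FrobeniusOrbits.

(** * Construction of the splitting field and the fixed field *)

(** There are finitely many polynomials of size at most [B]; a splitting field of the product of the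
    nonzero ones splits each of them. *)
Lemma exists_splitting_finField (F : finFieldType) B :
  exists (L : finFieldType) (iota : {rmorphism F -> L}),
    forall g : {poly F}, g != 0 -> (size g <= B)%N ->
    exists rs : seq L, map_poly iota g %= \prod_(z <- rs) ('X - z%:P).
Proof.
pose P : {poly F} := \prod_(h : {poly_B F} | polyn h != 0) polyn h.
have nzP : P != 0 by apply/prodf_neq0.
have [L [rs split_P _]] := FinSplittingFieldFor nzP.
exists (FinFieldExtType L), (GRing.in_alg L) => g nz_g szg.
have dvd_gP : g %| P by rewrite /P (bigD1 (NPoly szg)) //= dvdp_mulr.
have: map_poly (GRing.in_alg L) g %| \prod_(z <- rs) ('X - z%:P).
  by rewrite -(eqp_dvdr _ split_P) dvdp_map.
by case/dvdp_prod_XsubC=> m split_g; exists (mask m rs).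
Qed.

Section FixedField.

Variables (F : finFieldType) (sigma : {rmorphism F -> F}).

Definition fixed_pred : pred F := fun x => sigma x == x.

Lemma fixed_divring_closed : divring_closed fixed_pred.
Proof.
split=> [|x y|x y]; rewrite !unfold_in /fixed_pred ?rmorph1 //.
  by move=> /eqP fx /eqP fy; rewrite rmorphB /= fx fy.
by move=> /eqP fx /eqP fy; rewrite rmorphM fmorphV /= fx fy.
Qed.

HB.instance Definition _ :=
  GRing.isDivringClosed.Build F fixed_pred fixed_divring_closed.

Record fixed_field := FixedField { fixed_val :> F; _ : fixed_val \in fixed_pred }.

HB.instance Definition _ := [isSub for fixed_val].
HB.instance Definition _ := [Finite of fixed_field by <:].
HB.instance Definition _ := [SubChoice_isSubIntegralDomain of fixed_field by <:].
HB.instance Definition _ := [SubIntegralDomain_isSubField of fixed_field by <:].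

Lemma card_fixed_field : #|{: fixed_field}| = #|[set x | sigma x == x]|.
Proof.
by rewrite card_sub; apply: eq_card => x; rewrite [in RHS]inE.
Qed.

End FixedField.

(** By induction: X^(q^(r+1)) - X is the sum of (X^(q^r))^q - X^q, a multiple of X^(q^r) - X, and of
    X^q - X. *)
Lemma dvdp_frob (F : fieldType) (q r : nat) : (0 < r)%N ->
  'X^q - 'X %| ('X^(q ^ r) - 'X : {poly F}).
Proof.
elim: r => // -[_ _|r IH _]; first by rewrite expn1.
rewrite -(subrK ('X^q) ('X^(q ^ r.+2))) -addrA dvdp_add //.
by rewrite expnSr exprM subrXX dvdp_mulr // IH.
Qed.

(** X^q - X divides X^#|F| - X, which splits over [F], so [sigma] has exactly [q] fixed points. *)
Lemma exists_fixed_field (p a q r : nat) (F : finFieldType)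
    (sigma : {rmorphism F -> F}) :
    prime p -> (0 < a)%N -> q = (p ^ a)%N -> (0 < r)%N -> #|F| = (q ^ r)%N ->
    (forall x, sigma x = x ^+ q) ->
  exists (K : finFieldType) (kappa : {rmorphism K -> F}), #|K| = q.
Proof.
move=> pr_p a_gt0 defq r_gt0 cardF sigmaE.
exists (fixed_field sigma), (val : {rmorphism fixed_field sigma -> F}).
have charF : p \in [pchar F].
  by apply: (@card_finPcharP F p (a * r)); rewrite // cardF defq expnM.
have [m split_q] : {m : bitseq |
    'X^(q ^ 1) - 'X %= \prod_(x <- mask m (enum F)) ('X - x%:P)}.
  apply: dvdp_prod_XsubC.
  by rewrite expn1 big_enum /= -finField_genPoly cardF dvdp_frob.
rewrite card_fixed_field -[RHS]expn1 -(card_fix_frob charF a_gt0 defq _ split_q) //.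
by apply: eq_card => x; rewrite !inE sigmaE.
Qed.

(** * Degree one and the final count *)

(** Degrees add under the skew product, so every polynomial of degree 1 is irreducible. *)
Lemma card_skew_irreducible1 (F : finFieldType) (sigma : {rmorphism F -> F}) :
  exists s : seq (skewpoly sigma),
    [/\ uniq s, forall f : skewpoly sigma, f \in s <-> monic_irreducible_deg 1 f &
        size s = #|F|].
Proof.
exists (monic_polys F 1 : seq (skewpoly sigma)); split.
- exact: monic_polys_uniq.
- move=> f; change ((f : {poly F}) \in monic_polys F 1 <-> monic_irreducible_deg 1 f).
  rewrite mem_monic_polys; split=> [/andP[mon_f /eqP szf] | [mon_f szf _]]; last first.
    by rewrite mon_f szf.
  split=> //; split=> [||g h def_f].
  + by change ((f : {poly F}) != 0); rewrite -size_poly_gt0 szf.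
  + by change (~~ (size (f : {poly F}) == 1%N)); rewrite szf.
  change ((size (g : {poly F}) == 1%N) || (size (h : {poly F}) == 1%N)).
  change (f = skew_mul sigma g h) in def_f.
  have nz_f : (f : {poly F}) != 0 by rewrite -size_poly_gt0 szf.
  have nz_g : (g : {poly F}) != 0.
    by apply: contraNneq nz_f => g0; rewrite def_f g0 skew_mul0l.
  have nz_h : (h : {poly F}) != 0.
    by apply: contraNneq nz_f => h0; rewrite def_f h0 skew_mul0r.
  have := size_skew_mul sigma nz_g nz_h; rewrite -def_f szf.
  move: nz_g nz_h; rewrite -!size_poly_gt0.
  by move: (size (g : {poly F})) (size (h : {poly F})) => m n; lia.
by rewrite size_map -cardE card_npoly expn1.
Qed.

(* hdr: for d = 1 and 1 < r the formula fails. Every X - a is irreducible, so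
   the count is q ^ r, while the formula gives q * (q ^ r - 1) / (q - 1).     *)
Theorem corollary2p5p3 (p a q r d : nat) (F : finFieldType)
    (sigma : {rmorphism F -> F})
    (hp : prime p) (ha : (0 < a)%N) (hq : q = (p ^ a)%N)
    (hr : (1 <= r)%N) (hd : (1 <= d)%N)
    (hF : #|F| = (q ^ r)%N) (hsigma : forall x : F, sigma x = x ^+ q)
    (hdr : (1 < d)%N \/ r = 1%N) :
  exists s : seq (skewpoly sigma),
    [/\ uniq s,
        forall f : skewpoly sigma, f \in s <-> monic_irreducible_deg d f &
        (size s)%:Q =
          (q%:Q ^+ (d * r) - 1) / (d%:Q * (q%:Q ^+ d - 1)) *
          \sum_(i <- divisors d) (moebius (d %/ i))%:Q * q%:Q ^+ i].
Proof.
have q_gt1 : (1 < q)%N by rewrite hq -(exp1n a) ltn_exp2r ?prime_gt1.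
have qX_gt1 n : (0 < n)%N -> (1 < q ^ n)%N.
  by move=> n_gt0; rewrite -(exp1n n) ltn_exp2r.
have natq_sub1 n : (q ^ n).-1%:Q = q%:Q ^+ n - 1.
  by rewrite -subn1 -subzn ?expn_gt0 ?(ltnW q_gt1) // rmorphB -natrX.
(* For [d = 1] the irreducible [X] kills no nonzero vector, so the double count would miss it; with
   [r = 1] both sides are [q]. *)
have [d_gt1 | d_le1] := ltnP 1 d; last first.
  have d1 : d = 1%N by apply/eqP; rewrite eqn_leq d_le1.
  case: hdr => [|r1]; first by rewrite d1.
  have [s [Us mem_s sz_s]] := card_skew_irreducible1 sigma.
  rewrite d1; exists s; split=> //.
  rewrite sz_s hF r1 !expn1 [divisors 1]/= big_seq1 divn1 moebius1 muln1 !mul1r !expr1.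
  rewrite divff ?mul1r // subr_eq0.
  by rewrite (eqr_int _ q 1) eqz_nat gtn_eqF.
have [K [kappa cardK]] := exists_fixed_field hp ha hq hr hF hsigma.
(* The largest polynomial to split is the linearization of a polynomial of degree [d] over [K], of
   degree [q ^ (r * d)]; its size is one more. *)
have [L [iota split_L]] := exists_splitting_finField F (q ^ (r * d)).+1.
have charF : p \in [pchar F].
  by apply: (@card_finPcharP F p (a * r)); rewrite // hF hq expnM.
have charL : p \in [pchar L] by rewrite (fmorph_pchar iota).
have [s [Us mem_s card_s]] := card_skew_irreducible kappa charL ha hq hr cardK hF
  hsigma split_L d_gt1 (ltnSn _).
exists s; split=> //.
have le_q n : (n <= d)%N -> (q ^ n <= q ^ (r * d))%N.
  move=> le_nd; rewrite leq_pexp2l ?(ltnW q_gt1) // (leq_trans le_nd) //.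
  by rewrite leq_pmull.
have card_order : #|[set x : L | order (frob q (L := L)) x == d]| =
    (size (monic_irreducibles K d) * d)%N.
  apply: (card_order_frob (iota := iota \o kappa) charL ha hq cardK) => N irrN szN.
  have nz_N : N != 0 := irredp_neq0 irrN.
  have [||rs] := split_L (map_poly kappa N).
  - by rewrite map_poly_eq0.
  - rewrite size_map_poly szN ltnS (leq_trans _ (le_q _ (leqnn d))) //.
    by rewrite ltnW // ltn_expl.
  rewrite -map_poly_comp => split_N.
  have: (0 < size rs)%N.
    rewrite -ltnS -(size_prod_XsubC rs id) -(eqp_size split_N) size_map_poly szN.
    by rewrite ltnS ltnW.
  case: rs split_N => // x rs split_N _; exists x.
  by rewrite (eqp_root split_N) root_prod_XsubC mem_head.
have card_fix n : (0 < n <= d)%N ->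
    #|[set x : L | iter n (frob q (L := L)) x == x]| = (q ^ n)%N.
  case/andP=> n_gt0 le_nd; have qn_gt1 := qX_gt1 n n_gt0.
  have sz : size ('X^(q ^ n) - 'X : {poly F}) = (q ^ n).+1.
    by rewrite size_polyDl ?size_polyXn // size_polyN size_polyX.
  have [||rs] := split_L ('X^(q ^ n) - 'X).
  - by rewrite -size_poly_gt0 sz.
  - by rewrite sz ltnS le_q.
  rewrite rmorphB /= map_polyXn map_polyX => split_X.
  exact (card_fix_frob charL ha hq n_gt0 split_X).
have := card_order_frob_moebius charL hq hd card_fix.
rewrite card_order => /(congr1 (fun z : int => z%:~R : rat)).
rewrite rmorph_sum /=.
rewrite (eq_bigr (fun i => (moebius (d %/ i))%:Q * q%:Q ^+ i)); last first.
  by move=> i _; rewrite rmorphM /= -natrX.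
move=> <-; rewrite -!natq_sub1 [(d * r)%N]mulnC PoszM rmorphM /=.
have nz_d : d%:Q != 0 by rewrite intr_eq0 eqz_nat -lt0n.
have nz_q : (q ^ d).-1%:Q != 0
  by rewrite intr_eq0 eqz_nat -lt0n -subn1 subn_gt0 qX_gt1.
move/(congr1 (fun m : nat => m%:Q)): card_s; rewrite !PoszM !rmorphM /= => card_s.
(* Multiplying by [q ^ d - 1] turns the left side into the double count. *)
apply: (mulIf nz_q); rewrite card_s.
by field; rewrite nz_d nz_q.
Qed.
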